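(* Let $G$ be the infinite grid graph with vertex set $\mathbb{Z}^2$, $\sigma$ a distinguished face, and $k$ a nonnegative integer. Let $K$ be the face configuration with $K_\sigma=k$ and $K_\tau=0$ for all faces $\tau\ne\sigma$. Then every run of the flow-firing process for $(G,\sigma)$ started from $K$ terminates after finitely many steps, and it always terminates at the same configuration $K^\bullet$, given by $$K^\bullet_\sigma=k,\qquad K^\bullet_\tau=\max\{0,\,k-\mathrm{dist}(\sigma,\tau)+1\}\ \text{ for all faces }\tau\neq\sigma.$$
   Context: Faces of $G$ are the unit squares of $\mathbb{Z}^2$; two faces are neighbors if they share an edge. $\mathrm{dist}(\sigma,\tau)$ is the distance in the dual graph of $G$ (the Manhattan distance between the squares). A face configuration assigns an integer $F_\tau$ to each face. Flow-firing process for $(G,\sigma)$ in the face representation: at each step choose two neighboring faces $a,b$, and: if $a\neq\sigma$, $b\neq\sigma$ and $F_a\ge F_b+2$, replace $F_a$ by $F_a-1$ and $F_b$ by $F_b+1$; if $b=\sigma$ and $F_\sigma>F_a$, replace $F_a$ by $F_a+1$; if $b=\sigma$ and $F_\sigma<F_a$, replace $F_a$ by $F_a-1$. The process terminates when no move is possible. (Equivalently, in edge terms: $K$ is $k$ units of flow circulating around $\sigma$; an edge not in $\sigma$ fires when it carries at least $2$ units of flow, rerouting one unit across each of its two faces; an edge of $\sigma$ fires when it carries at least $1$ unit, rerouting one unit across the face other than $\sigma$ containing it.) *)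

(* Defs.v *)
From mathcomp Require Import all_boot all_order all_algebra.
From mathcomp Require Import boolp zify.

Set Implicit Arguments.
Unset Strict Implicit.
Unset Printing Implicit Defensive.

Import Order.TTheory GRing.Theory Num.Theory.
Local Open Scope ring_scope.

Notation vertex := (int * int)%type.

(* An edge is listed from its lower-left to its upper-right endpoint, so each
   edge of the grid has a unique representation. *)
Notation edge := (vertex * vertex)%type.

(* A unit square is represented by its lower-left corner. *)
Notation face := (int * int)%type.

Definition face_edges (f : face) : seq edge :=
  let: (x, y) := f in
  [:: ((x, y), (x + 1, y));
      ((x, y + 1), (x + 1, y + 1));
      ((x, y), (x, y + 1));
      ((x + 1, y), (x + 1, y + 1))].

Definition neighbors : rel face :=
  fun a b => (a != b) && has (mem (face_edges b)) (face_edges a).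

Definition dual_walk (s t : face) (n : nat) : Prop :=
  exists p : seq face, [/\ path neighbors s p, last s p = t & size p = n].

Lemma dual_walk_exists (s t : face) : exists n : nat, `[< dual_walk s t n >].
Proof.
have catw a b c : (exists n, dual_walk a b n) -> (exists n, dual_walk b c n) ->
    exists n, dual_walk a c n.
  move=> [_ [p [pP <- _]]] [_ [q [qP <- _]]].
  by exists (size (p ++ q)), (p ++ q); rewrite cat_path last_cat pP qP.
have one a b : neighbors a b -> exists n, dual_walk a b n.
  by move=> ab; exists 1%N, [:: b]; rewrite /= ab.
have nbrP (x y x' y' : int) : (x' = x /\ y' = y + 1) \/ (x' = x + 1 /\ y' = y) ->
    neighbors (x, y) (x', y') && neighbors (x', y') (x, y).
  case=> -[-> ->]; rewrite /neighbors /= !inE !xpair_eqE !eqxx /= ?orbT ?andbT;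
    lia.
have hor (m : nat) (x y : int) : (exists n, dual_walk (x, y) (x + m%:Z, y) n) /\
    (exists n, dual_walk (x + m%:Z, y) (x, y) n).
  elim: m => [|m [IH1 IH2]].
    by rewrite addr0; split; exists 0%N, [::].
  have /andP[h1 h2] := nbrP (x + m%:Z) y (x + m.+1%:Z) y ltac:(lia).
  by split; [apply: catw IH1 (one _ _ h1) | apply: catw (one _ _ h2) IH2].
have ver (m : nat) (x y : int) : (exists n, dual_walk (x, y) (x, y + m%:Z) n) /\
    (exists n, dual_walk (x, y + m%:Z) (x, y) n).
  elim: m => [|m [IH1 IH2]].
    by rewrite addr0; split; exists 0%N, [::].
  have /andP[h1 h2] := nbrP x (y + m%:Z) x (y + m.+1%:Z) ltac:(lia).
  by split; [apply: catw IH1 (one _ _ h1) | apply: catw (one _ _ h2) IH2].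
suff [n w] : exists n, dual_walk s t n by exists n; apply/asboolP.
case: s t => x y [x' y']; apply: (catw _ (x', y)).
  have [xx'|x'x] := leP x x'.
    by have [+ _] := hor `|x' - x|%N x y;
      have -> : x + `|x' - x|%N%:Z = x' by lia.
  by have [_ +] := hor `|x - x'|%N x' y;
    have -> : x' + `|x - x'|%N%:Z = x by lia.
have [yy'|y'y] := leP y y'.
  by have [+ _] := ver `|y' - y|%N x' y;
    have -> : y + `|y' - y|%N%:Z = y' by lia.
by have [_ +] := ver `|y - y'|%N x' y';
  have -> : y' + `|y - y'|%N%:Z = y by lia.
Qed.

Definition dist (s t : face) : nat := ex_minn (dual_walk_exists s t).

Definition config := face -> int.

Definition upd (F : config) (a : face) (v : int) : config :=
  fun c => if c == a then v else F c.

Inductive step (sigma : face) (F : config) : config -> Prop :=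
| Fire_interior a b of neighbors a b & a != sigma & b != sigma
    & F b + 2 <= F a :
    step sigma F (upd (upd F a (F a - 1)) b (F b + 1))
| Fire_sigma_up a of neighbors a sigma & F a < F sigma :
    step sigma F (upd F a (F a + 1))
| Fire_sigma_down a of neighbors a sigma & F sigma < F a :
    step sigma F (upd F a (F a - 1)).

Inductive reachable (sigma : face) (F : config) : config -> Prop :=
| Reach_refl : reachable sigma F F
| Reach_step F' F'' of reachable sigma F F' & step sigma F' F'' :
    reachable sigma F F''.

Definition terminal (sigma : face) (F : config) : Prop :=
  forall F', ~ step sigma F F'.

Definition infinite_run (sigma : face) (F : config) (u : nat -> config) : Prop :=
  u 0%N = F /\ forall n, step sigma (u n) (u n.+1).

Definition pulse (sigma : face) (k : nat) : config :=
  fun t => if t == sigma then k%:Z else 0.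

Definition pulse_final (sigma : face) (k : nat) : config :=
  fun t => if t == sigma then k%:Z
           else Num.max 0 (k%:Z - (dist sigma t)%:Z + 1).

(* Main.v *)
Require Import Defs.
From mathcomp Require Import all_boot all_order all_algebra.
From mathcomp Require Import boolp zify ring.

Set Implicit Arguments.
Unset Strict Implicit.
Unset Printing Implicit Defensive.

Import Order.TTheory GRing.Theory Num.Theory.
Local Open Scope ring_scope.

(** The pointwise bounds [0 <= F <= pulse_final] with [F sigma = k] are
    preserved by every step, because away from [sigma] the final configuration
    is 1-Lipschitz on the dual graph and a firing from [a] to [b] leaves
    [F b] at most [F a - 1].  The bounds confine all changes to a finite ball,
    over which the sum of the squares [(k - F t)^2] drops at each step; hence
    termination.  In a terminal configuration the neighbors of [sigma] carry [k]
    and the values drop by at most 1 along a geodesic from [sigma], which gives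
    the matching lower bound. *)

Lemma neighbors_sym : symmetric neighbors.
Proof. by move=> a b; rewrite /neighbors eq_sym has_sym. Qed.

Lemma dist_walk (s t : face) : dual_walk s t (dist s t).
Proof. by rewrite /dist; case: ex_minnP => n /asboolP. Qed.

Lemma dist_le (s t : face) (n : nat) : dual_walk s t n -> (dist s t <= n)%N.
Proof. by rewrite /dist; case: ex_minnP => m _ min w; apply/min/asboolP. Qed.

Lemma dist_eq0 (s t : face) : (dist s t == 0%N) = (t == s).
Proof.
apply/eqP/eqP => [d0|->].
  by have := dist_walk s t; rewrite d0 => -[p [_ <- /size0nil->]].
by apply/eqP; rewrite -leqn0; apply: dist_le; exists [::].
Qed.

Lemma dist_neighbor (s a b : face) :
  neighbors a b -> (dist s b <= (dist s a).+1)%N.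
Proof.
move=> ab; have [p [pP lp sp]] := dist_walk s a.
by apply: dist_le; exists (rcons p b); rewrite rcons_path last_rcons size_rcons pP lp ab sp.
Qed.

(** The predecessor is the last but one face of a shortest walk. The truncated walk bounds its
    distance by [d], and [dist_neighbor] excludes anything smaller. *)
Lemma dist_pred (s t : face) (d : nat) :
  dist s t = d.+1 -> exists2 r, neighbors r t & dist s r = d.
Proof.
move=> dE; have := dist_walk s t; rewrite dE => -[p].
case/lastP: p => [[_ _ //]|p x]; rewrite rcons_path last_rcons size_rcons.
case=> /andP[pP xP] xt [sp]; subst x; exists (last s p) => //.
apply/eqP; rewrite eqn_leq; apply/andP; split; first by apply: dist_le; exists p.
by rewrite -ltnS -dE dist_neighbor.
Qed.

Lemma neighbors_finite (a : face) :
  exists B : seq face, forall b, neighbors a b -> b \in B.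
Proof.
case: a => x y; exists [:: (x + 1, y); (x - 1, y); (x, y + 1); (x, y - 1)].
case=> x' y' /andP[]; rewrite /= !inE !xpair_eqE orbF => ne.
by do ![case/orP]; move=> /andP[/andP[/eqP ? /eqP ?] /andP[/eqP ? /eqP ?]]; lia.
Qed.

Lemma ball_finite (s : face) (n : nat) :
  exists B : seq face, forall t, (dist s t <= n)%N -> t \in B.
Proof.
elim: n => [|n [B BP]].
  by exists [:: s] => t; rewrite leqn0 dist_eq0 inE.
(* The next ball is the old one together with the neighbors of its faces. *)
have [nb nbP] := choice neighbors_finite.
exists (B ++ flatten (map nb B)) => t; rewrite leq_eqVlt mem_cat.
case/orP=> [/eqP dt|/BP-> //]; have [r rt dr] := dist_pred dt.
by apply/orP; right; apply/flatten_mapP; exists r; [apply: BP; rewrite dr|exact: nbP].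
Qed.

(** Deviations are measured from [k] so that a firing at [sigma], which alters the total of the
    other faces, also lowers the sum. *)
Definition energy (B : seq face) (k : nat) (F : config) : int :=
  \sum_(t <- B) (k%:Z - F t) ^+ 2.

Lemma energy_ge0 B k F : 0 <= energy B k F.
Proof. by apply: sumr_ge0 => t _; exact: sqr_ge0. Qed.

Lemma energy_upd B k F a v : uniq B -> a \in B ->
  energy B k (upd F a v) =
  energy B k F - (k%:Z - F a) ^+ 2 + (k%:Z - v) ^+ 2.
Proof.
move=> uB aB; rewrite /energy !(bigD1_seq a aB uB) /= {1}/upd eqxx.
rewrite (eq_bigr (fun t => (k%:Z - F t) ^+ 2)) => [|t /negPf ta]; last by rewrite /upd ta.
by ring.
Qed.

Definition below_final (sigma : face) (k : nat) (F : config) : Prop :=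
  F sigma = k%:Z /\ forall t, 0 <= F t <= pulse_final sigma k t.

Lemma pulse_final_le sigma k t : pulse_final sigma k t <= k%:Z.
Proof.
rewrite /pulse_final; case: ifPn => // ts.
by have := dist_eq0 sigma t; rewrite (negPf ts); lia.
Qed.

Lemma pulse_final_lipschitz sigma k a b :
  neighbors a b -> a != sigma -> b != sigma ->
  pulse_final sigma k a <= pulse_final sigma k b + 1.
Proof.
move=> ab sa sb; rewrite /pulse_final (negPf sa) (negPf sb).
by have := dist_neighbor sigma ab; lia.
Qed.

Lemma pulse_final_adjacent sigma k a :
  neighbors a sigma -> pulse_final sigma k a = k%:Z.
Proof.
move=> as_; rewrite /pulse_final; case: ifPn => // sa.
rewrite neighbors_sym in as_.
have := dist_neighbor sigma as_; have := dist_eq0 sigma a; have := dist_eq0 sigma sigma.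
by rewrite eqxx (negPf sa); lia.
Qed.

Lemma pulse_final_support sigma k t :
  0 < pulse_final sigma k t -> (dist sigma t <= k)%N.
Proof.
rewrite /pulse_final; have := dist_eq0 sigma t; case: ifPn => _; lia.
Qed.

Lemma below_final_pulse sigma k : below_final sigma k (pulse sigma k).
Proof.
split=> [|t]; first by rewrite /pulse eqxx.
by rewrite /pulse /pulse_final; case: ifP => _; lia.
Qed.

Lemma below_final_step sigma k F F' :
  below_final sigma k F -> step sigma F F' -> below_final sigma k F'.
Proof.
move=> [Fs FP] [a b ab sa sb Fab|a as_ Fa|a as_ Fa].
- split=> [|t]; first by rewrite /upd ![sigma == _]eq_sym (negPf sa) (negPf sb).
  (* The receiving face keeps its bound: [F b + 1 <= F a - 1 <= pulse_final sigma k a - 1 <=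
     pulse_final sigma k b]. *)
  have := pulse_final_lipschitz k ab sa sb.
  have := FP a; have := FP b; have := FP t; rewrite /upd.
  by case: (t =P b) => [->|_]; [|case: (t =P a) => [->|_]]; lia.
- have /andP[/negPf sa _] := as_.
  split=> [|t]; first by rewrite /upd eq_sym sa.
  have := pulse_final_adjacent k as_; have := FP a; have := FP t; rewrite /upd.
  by case: (t =P a) => [->|_]; lia.
(* No face ever exceeds [k = F sigma], so this firing cannot occur. *)
- by have := FP a; have := pulse_final_le sigma k a; lia.
Qed.

Lemma below_final_reachable sigma k F :
  reachable sigma (pulse sigma k) F -> below_final sigma k F.
Proof.
elim=> [|F' F'' _ IH st]; first exact: below_final_pulse.
exact: below_final_step st.
Qed.

(** An interior firing lowers the energy by [2 * (F a - F b - 1) >= 2], a firing at [sigma] by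
    [2 * (k - F a) - 1 >= 1]. *)
Lemma energy_step sigma k B F F' : uniq B ->
    (forall t, (dist sigma t <= k)%N -> t \in B) ->
    below_final sigma k F -> step sigma F F' ->
  energy B k F' < energy B k F.
Proof.
move=> uB BP inv st; have [_ FP'] := below_final_step inv st.
have inB t : 0 < pulse_final sigma k t -> t \in B by move/pulse_final_support/BP.
case: inv => Fs FP; case: st FP' => [a b ab sa sb Fab|a as_ Fa|a as_ Fa] FP'.
- have /andP[/negPf nab _] := ab.
  have aB : a \in B by apply: inB; have := FP a; have := FP b; lia.
  (* [F b] may be 0, so positivity of the bound at [b] is read off after the step, where [b] carries
     [F b + 1]. *)
  have bB : b \in B.
    by apply: inB; have := FP' b; have := FP b; rewrite /upd eqxx; lia.
  by rewrite !energy_upd // {1}/upd eq_sym nab; nia.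
- have aB : a \in B.
    by apply: inB; have := FP' a; have := FP a; rewrite /upd eqxx; lia.
  by rewrite energy_upd //; nia.
- by have := FP a; have := pulse_final_le sigma k a; lia.
Qed.

(** Induction on the distance: a face below the bound could receive flow from its predecessor on a
    geodesic. *)
Lemma terminal_ge sigma k F t : below_final sigma k F -> terminal sigma F ->
  t != sigma -> k%:Z - (dist sigma t)%:Z + 1 <= F t.
Proof.
move=> [Fs FP] term; move E: (dist sigma t) => d.
elim: d t E => [|d IH] t dt ts.
  by move/eqP: dt; rewrite dist_eq0 (negPf ts).
have [r rt dr] := dist_pred dt; have [rs|rs] := eqVneq r sigma.
  rewrite rs neighbors_sym in rt; rewrite leNgt; apply/negP => lt.
  apply: (term (upd F t (F t + 1))); apply: Fire_sigma_up => //; lia.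
(* Here [F r >= k - d + 1] and [F t <= k - d - 1], exactly the gap of 2 that an interior firing
   requires. *)
rewrite leNgt; apply/negP => lt; have := IH _ dr rs => Fr.
apply: (term (upd (upd F r (F r - 1)) t (F t + 1))).
by apply: Fire_interior => //; lia.
Qed.

Theorem theorem6p4 (sigma : face) (k : nat) :
  (forall u : nat -> config, ~ infinite_run sigma (pulse sigma k) u) /\
  (forall F : config, reachable sigma (pulse sigma k) F -> terminal sigma F ->
     F = pulse_final sigma k).
Proof.
split=> [u [u0 ust]|F /below_final_reachable inv term].
  have inv n : below_final sigma k (u n).
    elim: n => [|n IH]; first by rewrite u0; exact: below_final_pulse.
    exact: below_final_step (ust n).
  have [B BP] := ball_finite sigma k.
  have BP' t : (dist sigma t <= k)%N -> t \in undup B by rewrite mem_undup; exact: BP.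
  have drop n : energy (undup B) k (u n) + n%:Z <= energy (undup B) k (u 0%N).
    elim: n => [|n IH]; first by rewrite addr0.
    by have := energy_step (undup_uniq B) BP' (inv n) (ust n); lia.
  (* One step more than the initial energy would make the energy negative. *)
  have := drop `|energy (undup B) k (u 0%N)|.+1.
  by have := energy_ge0 (undup B) k (u `|energy (undup B) k (u 0%N)|.+1); lia.
apply: funext => t; have [Fs FP] := inv.
have [->|ts] := eqVneq t sigma; first by rewrite Fs /pulse_final eqxx.
have := terminal_ge inv term ts; have := FP t.
by rewrite /pulse_final (negPf ts); lia.
Qed.
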